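(* Let $R$ be a local admissible ring with $p\geq 2$ discrete valuation rings, and let $I\subseteq\mathrm{Frac}(R)$ be a fractional ideal. Let $RM(I)=\{\alpha^1,\ldots,\alpha^q\}$ be the (finite) set of the relative maximals of $I$. Let $v\in\mathbb{Z}^p$ be such that for all $J\subseteq\{1,\ldots,p\}$ with $|J|=p-1$ we have $pr_J(v)\in pr_J(\mathrm{val}(I))$. Then $v\in\mathrm{val}(I)$ if and only if for all $i\in\{1,\ldots,q\}$, $v\notin\Delta(\alpha^i,\mathbb{Z}^p)$.
   Context: **Admissible rings and values.** Let $(R,\mathfrak{m})$ be a one-dimensional Noetherian local Cohen-Macaulay ring, $\mathrm{Frac}(R)$ its total ring of fractions, $\widetilde{R}$ the integral closure of $R$ in $\mathrm{Frac}(R)$, and $\mathscr{V}$ the set of discrete valuation rings of $\mathrm{Frac}(R)$ over $R$. The ring $R$ is called admissible if (i) its completion $\widehat{R}$ is reduced; (ii) for every maximal ideal $\mathfrak{n}$ of $\widetilde{R}$, $\widetilde{R}/\mathfrak{n}=R/(\mathfrak{n}\cap R)$; (iii) $|R/\mathfrak{m}|\geq|\mathscr{V}|$. Put $p=|\mathscr{V}|$. Under (i), $\widetilde{R}$ is a finite product of semilocal principal ideal domains and $\mathrm{Frac}(R)$ is the product of their fraction fields; the elements of $\mathscr{V}$ correspond to the maximal ideals $\mathfrak{n}$ of $\widetilde{R}$, and the associated valuation of $x\in\mathrm{Frac}(R)$ is the $\mathfrak{n}$-adic valuation of the component of $x$ in the field factor to which $\mathfrak{n}$ belongs ($\infty$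 if this component is $0$). Numbering these valuations $\mathrm{val}_1,\ldots,\mathrm{val}_p$ gives the value map $\mathrm{val}=(\mathrm{val}_1,\ldots,\mathrm{val}_p):\mathrm{Frac}(R)\to(\mathbb{Z}\cup\{\infty\})^p$. **Fractional ideals.** A fractional ideal is an $R$-submodule $I\subseteq\mathrm{Frac}(R)$ containing a non zero divisor of $\mathrm{Frac}(R)$ and such that $gI\subseteq R$ for some non zero divisor $g\in R$. Its set of values is $\mathrm{val}(I)=\{\mathrm{val}(g): g\in I \text{ a non zero divisor}\}\subset\mathbb{Z}^p$. **Notation.** For $J\subseteq\{1,\ldots,p\}$, $pr_J:\mathbb{Z}^p\to\mathbb{Z}^{|J|}$ is $pr_J(v_1,\ldots,v_p)=(v_j)_{j\in J}$. For $\alpha\in\mathbb{Z}^p$, $\mathcal{E}\subseteq\mathbb{Z}^p$ and $J\subseteq\{1,\ldots,p\}$, let $\Delta_J(\alpha,\mathcal{E})=\{v\in\mathcal{E}: v_j=\alpha_j\ \forall j\in J,\ v_j>\alpha_j\ \forall j\notin J\}$, $\Delta_i(\alpha,\mathcal{E})=\Delta_{\{i\}}(\alpha,\mathcal{E})$, $\Delta(\alpha,\mathcal{E})=\bigcup_{i=1}^p\Delta_i(\alpha,\mathcal{E})$; for a fractional ideal $I$, write $\Delta_J(\alpha,I)=\Delta_J(\alpha,\mathrm{val}(I))$ and $\Delta(\alpha,I)=\Delta(\alpha,\mathrm{val}(I))$. **Relative maximals.** $\alpha\in\mathrm{val}(I)$ is a relative maximal of $I$ if $\Delta(\alpha,I)=\emptyset$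 and $\Delta_J(\alpha,I)\neq\emptyset$ for all $J\subseteq\{1,\ldots,p\}$ with $|J|\geq 2$. The set of relative maximals of a fractional ideal is finite. *)

(* Defs.v *)
From HB Require Import structures.
From mathcomp Require Import all_boot all_order all_algebra generic_quotient.
From mathcomp Require Import boolp classical_sets functions cardinality.
From mathcomp Require Import constructive_ereal.

Set Implicit Arguments.
Unset Strict Implicit.
Unset Printing Implicit Defensive.

Import Order.TTheory GRing.Theory Num.Theory.
Local Open Scope classical_set_scope.
Local Open Scope ring_scope.

Section Ideals.
Variable K : comPzRingType.

(* Ideals of a subring A of K; ideals of K itself are the case A = setT. *)
Definition is_ideal (A I : set K) : Prop :=
  [/\ I `<=` A, I 0, (forall x y, I x -> I y -> I (x + y)) &
      forall a x, A a -> I x -> I (a * x)].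

Definition proper_ideal_of (A I : set K) : Prop := is_ideal A I /\ ~ I 1.

Definition maximal_ideal (A n : set K) : Prop :=
  proper_ideal_of A n /\
  forall n', proper_ideal_of A n' -> n `<=` n' -> n' = n.

(* The set of cosets x + n for x in A. When n is an ideal of A this is A / n. *)
Definition quotient_by (A n : set K) : set (set K) :=
  [set [set y | n (y - x)] | x in A].

Definition gen_ideal (S : set K) : set K := smallest (is_ideal setT) S.

(* gen_ideal makes this an ideal of K even when m is not one; for n = 0 the
   empty product gives the unit ideal. *)
Definition ideal_pow (m : set K) (n : nat) : set K :=
  gen_ideal [set x | exists2 a : 'I_n -> K,
                       forall j, m (a j) & x = \prod_(j < n) a j].

Lemma gen_ideal_ideal (S : set K) : is_ideal setT (gen_ideal S).
Proof.
split=> // [I [[]] //|x y Ix Iy I II|a x _ Ix I II].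
  by case: (II) => -[_ _ addI _] _; apply: addI; [apply: Ix | apply: Iy].
by case: (II) => -[_ _ _ mulI] _; apply: mulI => //; apply: Ix.
Qed.

End Ideals.

Definition reduced (A : pzRingType) : Prop :=
  forall (x : A) (n : nat), x ^+ n = 0 -> x = 0.

Section LocalRings.
Variable R : comNzRingType.

Definition local_ring (m : set R) : Prop :=
  maximal_ideal setT m /\ forall n, maximal_ideal setT n -> n = m.

Definition noetherian : Prop :=
  forall I : set R, is_ideal setT I -> exists s : seq R, I = gen_ideal [set` s].

Definition prime_ideal (P : set R) : Prop :=
  proper_ideal_of setT P /\ forall x y, P (x * y) -> P x \/ P y.

Definition prime_chain (d : nat) : Prop :=
  exists P : nat -> set R,
    (forall i, (i <= d)%N -> prime_ideal (P i)) /\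
    (forall i, (i < d)%N -> P i `<` P i.+1).

Definition krull_dim (d : nat) : Prop :=
  prime_chain d /\ forall e, prime_chain e -> (e <= d)%N.

(* Each s_i is a non zero divisor modulo (s_0, ..., s_(i-1)). *)
Definition regular_sequence (m : set R) (s : seq R) : Prop :=
  [set` s] `<=` m /\
  forall i, (i < size s)%N -> forall x,
    gen_ideal [set` take i s] (s`_i * x) -> gen_ideal [set` take i s] x.

Definition depth (m : set R) (d : nat) : Prop :=
  (exists2 s, regular_sequence m s & size s = d) /\
  forall s, regular_sequence m s -> (size s <= d)%N.

Definition cohen_macaulay (m : set R) : Prop :=
  exists2 d, krull_dim d & depth m d.

End LocalRings.

(* The m-adic completion: Cauchy sequences modulo null sequences. *)
Section Completion.
Variables (R : comNzRingType) (m : set R).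

Definition cauchy : pred (nat -> R) := fun u =>
  `[< forall n, exists N, forall i j, (N <= i)%N -> (N <= j)%N ->
        ideal_pow m n (u i - u j) >].

Let powP n := gen_ideal_ideal
  [set x | exists2 a : 'I_n -> R, forall j, m (a j) & x = \prod_(j < n) a j].

Let pow0 n : ideal_pow m n 0. Proof. by case: (powP n). Qed.
Let powD n x y : ideal_pow m n x -> ideal_pow m n y -> ideal_pow m n (x + y).
Proof. by case: (powP n) => _ _ h _; apply: h. Qed.
Let powM n a x : ideal_pow m n x -> ideal_pow m n (a * x).
Proof. by case: (powP n) => _ _ _ h; apply: h. Qed.
Let powN n x : ideal_pow m n x -> ideal_pow m n (- x).
Proof. by rewrite -mulN1r; apply: powM. Qed.

Lemma cauchy_subring : subring_closed cauchy.
Proof.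
split.
- by apply/asboolP => n; exists 0%N => i j _ _; rewrite subrr.
- move=> u v /asboolP cu /asboolP cv; apply/asboolP => n.
  have [N hN] := cu n; have [M hM] := cv n.
  exists (maxn N M) => i j; rewrite !geq_max => /andP[Ni Mi] /andP[Nj Mj].
  rewrite [X in ideal_pow _ _ X](_ : _ = (u i - u j) + - (v i - v j)).
    by apply: powD; [exact: hN | apply: powN; exact: hM].
  by rewrite [in RHS]opprD [RHS]addrACA -[in RHS]opprD.
- move=> u v /asboolP cu /asboolP cv; apply/asboolP => n.
  have [N hN] := cu n; have [M hM] := cv n.
  exists (maxn N M) => i j; rewrite !geq_max => /andP[Ni Mi] /andP[Nj Mj].
  rewrite [X in ideal_pow _ _ X]
    (_ : _ = v i * (u i - u j) + u j * (v i - v j)).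
    by apply: powD; apply: powM; [exact: hN | exact: hM].
  by rewrite !mulrBr addrA [v i * u j]mulrC subrK [X in _ = X - _]mulrC.
Qed.
HB.instance Definition _ :=
  GRing.isSubringClosed.Build (nat -> R) cauchy cauchy_subring.

Record cauchy_seq := CauchySeq {cauchy_val : nat -> R; _ : cauchy_val \in cauchy}.
HB.instance Definition _ := [isSub for cauchy_val].
HB.instance Definition _ := [Choice of cauchy_seq by <:].
HB.instance Definition _ :=
  GRing.SubChoice_isSubComPzRing.Build (nat -> R) cauchy cauchy_seq
    cauchy_subring.

Definition null_seq : pred cauchy_seq := fun u =>
  `[< forall n, exists N, forall i, (N <= i)%N ->
        ideal_pow m n (cauchy_val u i) >].

Lemma null_seq_zmod : zmod_closed null_seq.
Proof.
split=> [|u v /asboolP cu /asboolP cv]; apply/asboolP => n.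
  by exists 0%N => i _; apply: pow0.
have [N hN] := cu n; have [M hM] := cv n.
exists (maxn N M) => i; rewrite geq_max => /andP[Ni Mi].
by apply: powD; [exact: hN | apply: powN; exact: hM].
Qed.
HB.instance Definition _ :=
  GRing.isZmodClosed.Build cauchy_seq null_seq null_seq_zmod.

Lemma null_seqM (a u : cauchy_seq) : u \in null_seq -> a * u \in null_seq.
Proof.
move=> /asboolP cu; apply/asboolP => n; have [N hN] := cu n.
by exists N => i Ni; apply: powM; apply: hN.
Qed.

Definition completion := Quotient.quot (GRing.ZmodClosed.clone _ null_seq _).
HB.instance Definition _ := GRing.Zmodule.on completion.
HB.instance Definition _ := EqQuotient.on completion.

Definition completion_one : completion := lift_cst completion 1.
Definition completion_mul : completion -> completion -> completion :=
  lift_op2 completion *%R.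

Let pi_eq (x y : cauchy_seq) :
  \pi_completion%qT x = \pi_completion%qT y <-> x - y \in null_seq.
Proof. by rewrite Quotient.idealrBE; split=> [/eqP|/eqP]. Qed.

Let pi_one : completion_one = \pi_completion%qT 1.
Proof. by rewrite /completion_one; unlock. Qed.

Let pi_mul (x y : cauchy_seq) :
  completion_mul (\pi_completion%qT x) (\pi_completion%qT y)
  = \pi_completion%qT (x * y).
Proof.
rewrite /completion_mul; unlock; apply/pi_eq.
set x' := repr _; set y' := repr _.
have hx : x' - x \in null_seq by apply/pi_eq; rewrite reprK.
have hy : y' - y \in null_seq by apply/pi_eq; rewrite reprK.
rewrite (_ : _ - _ = y' * (x' - x) + x * (y' - y)); last first.
  by rewrite !mulrBr addrA [y' * x]mulrC subrK mulrC.
by rewrite rpredD // null_seqM.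
Qed.

Let piE (P : completion -> Prop) :
  (forall x, P (\pi_completion%qT x)) -> forall x, P x.
Proof. by move=> h x; rewrite -[x]reprK. Qed.

Let mulA : associative completion_mul.
Proof.
by elim/piE=> x; elim/piE=> y; elim/piE=> z; rewrite !pi_mul mulrA.
Qed.

Let mulC : commutative completion_mul.
Proof. by elim/piE=> x; elim/piE=> y; rewrite !pi_mul mulrC. Qed.

Let mul1 : left_id completion_one completion_mul.
Proof. by elim/piE=> x; rewrite pi_one pi_mul mul1r. Qed.

Let pi_add (x y : cauchy_seq) :
  \pi_completion%qT (x + y) = \pi_completion%qT x + \pi_completion%qT y.
Proof. exact: Quotient.pi_add. Qed.

Let mulDl : left_distributive completion_mul +%R.
Proof.
elim/piE=> x; elim/piE=> y; elim/piE=> z.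
by rewrite -pi_add !pi_mul mulrDl pi_add.
Qed.

HB.instance Definition _ :=
  GRing.Zmodule_isComPzRing.Build completion mulA mulC mul1 mulDl.

End Completion.

Section Fractions.
Variables (R : comNzRingType) (K : comUnitRingType) (iota : {rmorphism R -> K}).

(* GRing.lreg says that multiplication by s is injective, i.e. that s is a non
   zero divisor. The predicate determines (K, iota) up to unique isomorphism. *)
Definition total_fractions : Prop :=
  [/\ injective iota,
      forall s : R, GRing.lreg s -> iota s \is a GRing.unit &
      forall x : K, exists a s : R, GRing.lreg s /\ x = iota a / iota s].

Definition integral_closure : set K := [set x | integralOver iota x].

(* A normalized discrete (Manis) valuation of the ring K, which may have zero
   divisors: elements other than 0 may have infinite value. Surjectivity onto
   Z u {oo} makes nu depend only on its valuation ring. *)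
Definition discrete_valuation (nu : K -> \bar int) : Prop :=
  [/\ range nu = [set n | n != -oo%E], nu 0 = +oo%E,
      forall x y, nu (x * y) = (nu x + nu y)%E &
      forall x y, (Order.min (nu x) (nu y) <= nu (x + y)%R)%E].

Definition valuation_ring (nu : K -> \bar int) : set K :=
  [set x | (0 <= nu x)%E].

Definition dvrs : set (set K) :=
  [set V | range iota `<=` V /\
           exists2 nu, discrete_valuation nu & V = valuation_ring nu].

Definition fractional_ideal (I : set K) : Prop :=
  [/\ [/\ I 0, forall x y, I x -> I y -> I (x + y) &
          forall r x, I x -> I (iota r * x)],
      exists2 x, I x & GRing.lreg x &
      exists2 g : R, GRing.lreg g & forall x, I x -> range iota (iota g * x)].

Definition admissible (m : set R) : Prop :=
  [/\ [/\ local_ring m, noetherian R, krull_dim R 1 & cohen_macaulay m],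
      total_fractions,
      reduced (completion m),
      (* R / iota^-1(n) is identified with its image in the quotient by n. *)
      forall n, maximal_ideal integral_closure n ->
        quotient_by integral_closure n = quotient_by (range iota) n &
      (dvrs #<= quotient_by setT m)%card].

(* val_1, ..., val_p are the valuations of the elements of dvrs, each listed
   once; in particular dvrs has p elements. *)
Definition value_map (p : nat) (val : 'I_p -> K -> \bar int) : Prop :=
  (forall i, discrete_valuation (val i)) /\
  set_bij setT dvrs (fun i => valuation_ring (val i)).

End Fractions.

Section Values.
Variable p : nat.
Local Notation Zp := {ffun 'I_p -> int}.

Definition values (K : comUnitRingType) (val : 'I_p -> K -> \bar int)
    (I : set K) : set Zp :=
  [set a | exists2 g, I g & GRing.lreg g /\ forall i, val i g = (a i)%:E].

Definition pr (J : {set 'I_p}) (v : Zp) : {ffun 'I_#|J| -> int} :=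
  [ffun k => v (enum_val k)].

Definition Delta_set (J : {set 'I_p}) (alpha : Zp) (E : set Zp) : set Zp :=
  [set v | [/\ E v, forall j, j \in J -> v j = alpha j &
                    forall j, j \notin J -> alpha j < v j]].

Definition Delta (alpha : Zp) (E : set Zp) : set Zp :=
  \bigcup_i Delta_set [set i]%SET alpha E.

Definition relative_maximals (E : set Zp) : set Zp :=
  [set alpha | [/\ E alpha, Delta alpha E = set0 &
     forall J : {set 'I_p}, (2 <= #|J|)%N -> Delta_set J alpha E !=set0]].

End Values.

(* Main.v *)
(* The value set E of I is closed under componentwise minima (a pencil g + r h
   has at least p + 1 members, each valuation spoils at most one) and has the
   exchange property: if a_i = b_i, subtracting a unit multiple cancels the
   leading terms at i.  Cancellation needs R to hit every residue of val_i:
   x = a/s satisfies a polynomial over R with a unit coefficient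
   (Krull-Akizuki), hence is a quotient of two integral elements of value 0,
   and these have residues in R/m by admissibility.  Zero divisors produced on
   the way are repaired by adding y^n x0 with y in m and n large.

   Now let v have all its codimension one projections in those of E.  If no
   element of E that equals v at i dominates v, take a minimal with a_i = v_i,
   a < v elsewhere, and Delta_i(a, E) empty.  Minimality yields elements of
   Delta_{i,k}(a, E) for all k, from which minima and exchange make a a relative
   maximal, and v lies in Delta_i(a, Z^p).  If there is no such i, then v is a
   minimum of p elements of E. *)
Require Import Defs.
From mathcomp Require Import all_boot all_order all_algebra.
From mathcomp Require Import boolp classical_sets functions cardinality.
From mathcomp Require Import constructive_ereal.
From mathcomp Require Import zify ring.

Set Implicit Arguments.
Unset Strict Implicit.
Unset Printing Implicit Defensive.

Import Order.TTheory GRing.Theory Num.Theory.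
Local Open Scope classical_set_scope.
Local Open Scope ring_scope.

(** * Combinatorics of subsets of Z^p closed under minima and exchange *)

Section ValueSets.
Variable p : nat.
Local Notation Zp := {ffun 'I_p -> int}.
Implicit Types (E : set Zp) (a b v : Zp) (J : {set 'I_p}).

Definition min_closed E := forall a b, E a -> E b ->
  E [ffun j => Order.min (a j) (b j)].

Definition exchange E := forall a b i, E a -> E b -> a i = b i ->
  exists c, [/\ E c, a i < c i, forall j, Order.min (a j) (b j) <= c j &
    forall j, a j != b j -> c j = Order.min (a j) (b j)].

Lemma min_closed_family E J (f : 'I_p -> Zp) : min_closed E ->
    J != finset.set0 -> (forall k, k \in J -> E (f k)) ->
  exists c, [/\ E c, forall j k, k \in J -> c j <= f k j &
    forall j, exists2 k, k \in J & c j = f k j].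
Proof.
move=> minE /set0Pn[k0 k0J] fE.
(* Prefixing [k0] to [enum J] lets the induction start from a one-element family. *)
suff [c [Ec le_c in_c]] : exists c, [/\ E c,
    forall j k, k \in k0 :: enum J -> c j <= f k j &
    forall j, exists2 k, k \in k0 :: enum J & c j = f k j].
  exists c; split=> // [j k kJ|j]; first by rewrite le_c // inE mem_enum kJ orbT.
  have [k] := in_c j; rewrite inE mem_enum => kJ ckj.
  by exists k => //; case/orP: kJ => [/eqP ->|].
have: {subset enum J <= J} by move=> k; rewrite mem_enum.
elim: (enum J) => [_|k s IH ksJ].
  exists (f k0); split=> [|j k|j]; first exact: fE.
    by rewrite inE => /eqP ->.
  by exists k0; rewrite ?inE.
have [|c [Ec le_c in_c]] := IH; first by move=> l ls; rewrite ksJ // inE ls orbT.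
exists [ffun j => Order.min (c j) (f k j)]; split.
- by apply: minE => //; apply: fE; rewrite ksJ // inE eqxx.
- move=> j l; rewrite ffunE !inE ge_min => /or3P[/eqP ->|/eqP ->|ls].
  + by rewrite le_c // inE eqxx.
  + by rewrite lexx orbT.
  + by rewrite le_c // inE ls orbT.
- move=> j; rewrite ffunE; have [_|_] := leP (c j) (f k j).
    have [l lks ->] := in_c j; exists l => //.
    by move: lks; rewrite !inE => /orP[->|->] //; rewrite !orbT.
  by exists k; rewrite // !inE eqxx orbT.
Qed.

Lemma exists_free_index E v : min_closed E -> (0 < p)%N -> ~ E v ->
  exists i, forall c, E c -> c i = v i -> ~ forall j, v j <= c j.
Proof.
move=> minE p_gt0 NEv; apply: contrapT => none; apply: NEv.
have above i : exists c, [/\ E c, c i = v i & forall j, v j <= c j].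
  apply: contrapT => Ni; apply: none; exists i => c Ec ci vc.
  by apply: Ni; exists c.
have {}[f fP] := choice above.
have Tn0 : [set: 'I_p]%SET != finset.set0.
  by apply/set0Pn; exists (Ordinal p_gt0); rewrite inE.
have [|c [Ec le_c in_c]] := min_closed_family (f := f) minE Tn0.
  by move=> k _; case: (fP k).
suff <- : c = v by [].
apply/ffunP => j; apply/eqP; rewrite eq_le; apply/andP; split.
  by case: (fP j) => _ <- _; apply: le_c; rewrite inE.
by have [k _ ->] := in_c j; case: (fP k).
Qed.

(** Off [i], the coordinates of a candidate [a] are bounded below by those of the elements supplied
    by the projections, so a minimal candidate exists. Lowering its coordinate [k] must make Delta_i
    nonempty, and the new element has value exactly [a k] at [k]. *)
Lemma minimal_empty_Delta E v i :
    (forall k, exists2 b, E b & forall j, j != k -> b j = v j) ->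
    (forall c, E c -> c i = v i -> ~ forall j, v j <= c j) ->
  exists a, [/\ a i = v i, forall j, j != i -> a j < v j,
    Delta_set [set i]%SET a E = set0 &
    forall k, k != i -> exists b, [/\ E b, b i = v i, b k = a k &
      forall j, j != i -> j != k -> a j < b j]].
Proof.
move=> proj free.
pose Q a := [/\ a i = v i, forall j, j != i -> a j < v j &
  Delta_set [set i]%SET a E = set0].
have {}proj k : exists b, E b /\ forall j, j != k -> b j = v j.
  by have [b] := proj k; exists b.
have {proj}[b bP] := choice proj.
have Q_lb a : Q a -> forall k, k != i -> b k k <= a k.
  case=> ai av Da k ki; rewrite leNgt; apply/negP => akb.
  have [Eb bv] := bP k.
  suff : set0 (b k) by [].
  rewrite -Da; split=> // j; rewrite !inE; [move=> /eqP -> | move=> ji].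
    by rewrite bv // eq_sym.
  by have [->//|jk] := eqVneq j k; rewrite bv // av.
pose mu a := (\sum_(j | j != i) `|a j - b j j|)%N.
have : exists n, `[< exists2 a, Q a & mu a = n >].
  (* Start from v lowered by one off [i]: an element of its Delta_i would dominate v and equal it at
     [i]. *)
  pose a : Zp := [ffun j => if j == i then v i else v j - 1].
  exists (mu a); apply/asboolP; exists a => //; split.
  - by rewrite ffunE eqxx.
  - by move=> j /negbTE ji; rewrite ffunE ji; lia.
  - rewrite -subset0 => c [Ec ca ac]; have ci : c i = v i.
      by rewrite ca ?inE // ffunE eqxx.
    apply: (free c Ec ci) => j; have [->|ji] := eqVneq j i; first by rewrite ci.
    by have := ac j; rewrite !inE ffunE (negbTE ji) => /(_ isT); lia.
case/ex_minnP => _ /asboolP[a Qa <-] a_min.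
have [ai av Da] := Qa; exists a; split=> // k ki.
pose a' : Zp := [ffun j => if j == k then a k - 1 else a j].
have : ~ Q a'.
  (* By [Q_lb] the lowered coordinate is still at least [b k k], so the distance [mu] really
     drops. *)
  move=> Qa'; have : (mu a <= mu a')%N by apply/a_min/asboolP; exists a'.
  rewrite /mu (bigD1 k) //= [in leqRHS](bigD1 k) //= ffunE eqxx.
  rewrite [in leqRHS](eq_bigr (fun j => `|a j - b j j|%N)); last first.
    by move=> j /andP[_ /negbTE jk]; rewrite ffunE jk.
  have := Q_lb _ Qa' k ki; rewrite ffunE eqxx leq_add2r; lia.
move=> NQ; apply: contrapT => none; apply: NQ; split.
- by rewrite ffunE eq_sym (negbTE ki).
- move=> j ji; rewrite ffunE; have := av _ ji; have := av _ ki.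
  by case: eqP => [->|_]; lia.
- rewrite -subset0 => c [Ec ca' a'c]; apply: none; exists c.
  have ci : c i = v i by rewrite ca' ?inE // ffunE eq_sym (negbTE ki).
  have ac j : j != i -> j != k -> a j < c j.
    by move=> ji /negbTE jk; have := a'c j; rewrite !inE ffunE jk => /(_ ji).
  split=> //; apply/eqP; rewrite eq_le; apply/andP; split; last first.
    by have := a'c k; rewrite !inE ffunE eqxx => /(_ ki); lia.
  rewrite leNgt; apply/negP => akc; suff : set0 c by [].
  rewrite -Da; split=> // j; rewrite !inE.
    by move=> /eqP ->; rewrite ci.
  move=> ji.
  by have [->//|jk] := eqVneq j k; exact: ac.
Qed.

Lemma relative_maximal_of_free_index E v i : (2 <= p)%N ->
    min_closed E -> exchange E ->
    (forall k, exists2 b, E b & forall j, j != k -> b j = v j) ->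
    (forall c, E c -> c i = v i -> ~ forall j, v j <= c j) ->
  exists2 a, relative_maximals E a & Delta_set [set i]%SET a setT v.
Proof.
move=> p_ge2 minE exE proj free.
have [a [ai av Da nbr]] := minimal_empty_Delta proj free.
exists a; last first.
  by split=> // j; rewrite !inE; [move=> /eqP -> | exact: av].
have {}nbr k : exists b, k != i -> [/\ E b, b i = v i, b k = a k &
    forall j, j != i -> j != k -> a j < b j].
  by have [->|/nbr[b ?]] := eqVneq k i; [exists a | exists b].
have {nbr}[b bP] := choice nbr.
have ab k j : k != i -> a j <= b k j.
  move=> ki; have [_ bi bk lt_ab] := bP k ki.
  have [->|ji] := eqVneq j i; first by rewrite ai bi.
  by have [->|jk] := eqVneq j k; [rewrite bk|rewrite ltW // lt_ab].
(* The minimum of the [b k] over [k] in J lies in Delta_{J u {i}}(a, E). *)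
have minb J : J != finset.set0 -> i \notin J -> exists c, [/\ E c, c i = v i,
    forall j, j \in J -> c j = a j &
    forall j, j != i -> j \notin J -> a j < c j].
  move=> Jn0 iJ; have JN k : k \in J -> k != i by apply: contraTneq => ->.
  have [|c [Ec le_c in_c]] := min_closed_family (f := b) minE Jn0.
    by move=> k /JN/bP[].
  exists c; split=> //.
  - by have [k /JN/bP[_ <- _ _]] := in_c i.
  - move=> j jJ; apply/eqP; rewrite eq_le; apply/andP; split.
      by have [_ _ <- _] := bP j (JN j jJ); apply: le_c.
    by have [k /JN ki ->] := in_c j; apply: ab.
  - move=> j ji jJ; have [k kJ ->] := in_c j.
    have [_ _ _ -> //] := bP k (JN k kJ).
    by apply: contraNneq jJ => ->.
split.
- have [||c [Ec ci ca _]] := @minb (~: [set i])%SET _ _.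
  + by rewrite -card_gt0 cardsC1 card_ord; case: p p_ge2 => [|[]].
  + by rewrite !inE eqxx.
  + suff -> : a = c by [].
    apply/ffunP => j; have [->|ji] := eqVneq j i; first by rewrite ai ci.
    by rewrite ca // !inE.
(* For [c] in Delta_k with [k != i], exchange with [b k] at [k] raises the value at [k] and keeps
   that of [b k] at [i], which produces an element of Delta_i. *)
- rewrite -subset0 => c [k _ Dk].
  have [ki|ki] := eqVneq k i; first by rewrite ki Da in Dk.
  case: Dk => Ec ck ac; have [Eb bi bk lt_ab] := bP k ki.
  have ckb : c k = b k k by rewrite bk ck ?inE.
  have [d [Ed dk le_d eq_d]] := exE _ _ _ Ec Eb ckb.
  suff : set0 d by [].
  have ic : a i < c i by apply: ac; rewrite !inE eq_sym.
  rewrite -Da; split=> // j; rewrite !inE; [move=> /eqP -> | move=> ji].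
    by rewrite eq_d bi ?ai; move: ic; rewrite ai; lia.
  have [->|jk] := eqVneq j k; first by rewrite -(ck k) ?inE.
  by apply: lt_le_trans (le_d j); rewrite lt_min lt_ab // ac // !inE.
- move=> J J_ge2; have [iJ|iJ] := boolP (i \in J).
    have [||c [Ec ci ca ac]] := @minb (J :\ i)%SET _ _.
    + by rewrite -card_gt0; move: J_ge2; rewrite (cardsD1 i) iJ.
    + by rewrite !inE eqxx.
    exists c; split=> // j jJ; last first.
      by apply: ac; [apply: contraNneq jJ => -> | rewrite !inE (negbTE jJ) andbF].
    have [->|ji] := eqVneq j i; first by rewrite ci ai.
    by rewrite ca // !inE ji.
  (* When [i] is outside J, [b k] and an element of Delta_{(J - k) u {i}} agree at [i]. Exchange
     raises the value at [i]; at each index of J exactly one of the two equals [a] and the other is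
     larger, so the result equals [a] on J. *)
  have /set0Pn[k kJ] : J != finset.set0 by rewrite -card_gt0; lia.
  have ki : k != i by apply: contraNneq iJ => <-.
  have [||c [Ec ci ca ac]] := @minb (J :\ k)%SET _ _.
  + by rewrite -card_gt0; move: J_ge2; rewrite (cardsD1 k) kJ.
  + by rewrite !inE (negbTE iJ) andbF.
  have [Eb bi bk lt_ab] := bP k ki.
  have bci : b k i = c i by rewrite bi ci.
  have [d [Ed di le_d eq_d]] := exE _ _ _ Eb Ec bci.
  exists d; split=> // j jJ.
    have ji : j != i by apply: contraNneq iJ => <-.
    have [->|jk] := eqVneq j k.
      have : a k < c k by apply: ac; rewrite // !inE eqxx.
      by move=> akc; rewrite eq_d bk; lia.
    have ajb := lt_ab j ji jk; have cj : c j = a j by rewrite ca // !inE jk.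
    by rewrite eq_d cj; lia.
  have [->|ji] := eqVneq j i; first by rewrite ai -bi.
  apply: lt_le_trans (le_d j); rewrite lt_min lt_ab //=.
    by apply: ac; rewrite // !inE (negbTE jJ) andbF.
  by apply: contraNneq jJ => ->.
Qed.

Lemma values_generated E v : (2 <= p)%N -> min_closed E -> exchange E ->
    (forall k, exists2 b, E b & forall j, j != k -> b j = v j) ->
  E v <-> forall a, relative_maximals E a -> ~ Delta a setT v.
Proof.
move=> p_ge2 minE exE proj; split.
  move=> Ev a [_ Da _] [k _ [_ va av]].
  suff : set0 v by [].
  by rewrite -Da; exists k.
move=> NDelta; apply: contrapT => NEv.
have [|i free] := exists_free_index minE _ NEv; first by lia.
have [a /NDelta Na Dv] := relative_maximal_of_free_index p_ge2 minE exE proj free.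
by apply: Na; exists i.
Qed.

End ValueSets.

(** * Noetherian local rings of dimension one *)

Section Noetherian.
Variable R : comNzRingType.
Implicit Types I J P : set R.

(** Otherwise choice gives a strictly increasing sequence in F; the finitely many generators of its
    union already lie in one term. *)
Lemma noetherian_maximal (F : set (set R)) : noetherian R ->
    F `<=` is_ideal setT -> F !=set0 ->
  exists2 I, F I & forall J, F J -> I `<=` J -> J `<=` I.
Proof.
move=> noethR idF [I0 FI0]; apply: contrapT => none.
have next (I : {I | F I}) : exists J : {J | F J}, sval I `<` sval J.
  apply: contrapT => NJ; apply: none; exists (sval I); first exact: svalP.
  move=> J FJ IJ; apply: contrapT => NJI.
  by apply: NJ; exists (exist _ J FJ).
have {next}[f fP] := choice next.
pose c n := sval (iter n f (exist _ I0 FI0)).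
have Fc n : F (c n) by exact: svalP.
have c_lt n : c n `<` c n.+1 by exact: fP.
have c_le m n : (m <= n)%N -> c m `<=` c n.
  elim: n => [|n IH]; first by rewrite leqn0 => /eqP ->.
  rewrite leq_eqVlt ltnS => /predU1P[->//|/IH cmn].
  by apply: subset_trans cmn _; case: (c_lt n).
pose U := \bigcup_n c n.
have idU : is_ideal setT U.
  split=> // [|x y [i _ cx] [j _ cy]|a x _ [i _ cx]].
  - by exists 0%N => //; case: (idF _ (Fc 0%N)).
  - exists (maxn i j) => //; case: (idF _ (Fc (maxn i j))) => _ _ + _; apply.
      exact: c_le (leq_maxl _ _) _ cx.
    exact: c_le (leq_maxr _ _) _ cy.
  - by exists i => //; case: (idF _ (Fc i)) => _ _ _; apply.
have [s Us] := noethR U idU.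
have sU x : x \in s -> U x by move=> xs; rewrite Us => I [_]; apply.
have [n cn] : exists n, [set` s] `<=` c n.
  elim: {Us}s sU => [_|x s IH sU]; first by exists 0%N.
  have [n cn] : exists n, [set` s] `<=` c n.
    by apply: IH => y ys; apply: sU; rewrite inE ys orbT.
  have [k _ ck] := sU x (mem_head _ _).
  exists (maxn k n) => y /=; rewrite inE => /predU1P[->|ys].
    exact: c_le (leq_maxl _ _) _ ck.
  by apply: c_le (leq_maxr _ _) _ (cn _ ys).
have [_] := c_lt n; apply=> x cx.
have : U x by exists n.+1.
by rewrite Us; apply; split=> //; exact: idF.
Qed.

Lemma noetherian_chain (c : nat -> set R) : noetherian R ->
    (forall n, is_ideal setT (c n)) -> (forall n, c n `<=` c n.+1) ->
  exists N, forall n, c n `<=` c N.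
Proof.
move=> noethR idc c_le.
have [||_ [N _ <-] maxN] := @noetherian_maximal (range c) noethR.
- by move=> _ [n _ <-].
- by exists (c 0%N), 0%N.
exists N => n; have [nN|/ltnW Nn] := leqP n N.
  by elim: N nN {maxN} => [|N IH];
    [rewrite leqn0 => /eqP -> |
     rewrite leq_eqVlt ltnS => /predU1P[->//|/IH cN];
     apply: subset_trans cN _].
apply: maxN; first by exists n.
elim: n Nn => [|n IH]; first by rewrite leqn0 => /eqP ->.
by rewrite leq_eqVlt ltnS => /predU1P[->//|/IH cN]; apply: subset_trans cN _.
Qed.

Lemma is_idealN I x : is_ideal setT I -> I x -> I (- x).
Proof. by case=> _ _ _ mulI Ix; rewrite -mulN1r; apply: mulI. Qed.

Lemma is_idealB I x y : is_ideal setT I -> I x -> I y -> I (x - y).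
Proof. by move=> idI Ix Iy; case: (idI) => _ _ + _; apply=> //; exact: is_idealN. Qed.

Section Local.
Variables (m : set R) (noethR : noetherian R) (localR : local_ring m).

Lemma local_maximal_ideal : is_ideal setT m. Proof. by case: localR => [[[]]]. Qed.

Lemma local_maximal_proper : ~ m 1. Proof. by case: localR => [[[]]]. Qed.

(** Noetherianity replaces Zorn's lemma: an ideal maximal among the proper ones above I is a maximal
    ideal, hence m. *)
Lemma proper_sub_maximal I : proper_ideal_of setT I -> I `<=` m.
Proof.
move=> propI.
have [||J [propJ IJ] maxJ] :=
    @noetherian_maximal [set J | proper_ideal_of setT J /\ I `<=` J] noethR.
- by move=> J [[]].
- by exists I; split.
suff <- : J = m by [].
case: localR => _; apply; split=> // J' propJ' JJ'; apply/seteqP; split=> //.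
by apply: maxJ => //; split=> //; exact: subset_trans JJ'.
Qed.

Lemma local_inv r : ~ m r -> exists r', r * r' = 1.
Proof.
move=> Nmr; apply: contrapT => Nr; apply: Nmr.
apply: (@proper_sub_maximal (range ( *%R r))); last by exists 1; rewrite ?mulr1.
split; last by move=> [r' _ rr']; apply: Nr; exists r'.
split=> // [|_ _ [a _ <-] [b _ <-]|a _ _ [b _ <-]].
- by exists 0; rewrite ?mulr0.
- by exists (a + b); rewrite ?mulrDr.
- by exists (a * b); rewrite // mulrCA.
Qed.

Lemma local_invP r : ~ m r <-> exists r', r * r' = 1.
Proof.
split=> [/local_inv //|[r' rr'] mr]; apply: local_maximal_proper.
by rewrite -rr' mulrC; case: local_maximal_ideal => _ _ _; apply.
Qed.

Lemma lreg_sub1 r : m r -> GRing.lreg (1 - r).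
Proof.
move=> mr; have [r' rr'] : exists r', (1 - r) * r' = 1.
  apply/local_invP => mr1; apply: local_maximal_proper.
  have [_ _ mD _] := local_maximal_ideal.
  by rewrite -(subrK r 1); apply: mD.
by apply: (can_inj (g := *%R r')) => x; rewrite mulrA (mulrC r') rr' mul1r.
Qed.

(* The annihilators of the nonzero elements of R_P form a family whose maximal
   elements are prime; such a prime misses s and lies strictly below P. *)
Lemma prime_lreg_maximal P s : krull_dim R 1 -> prime_ideal P ->
  P s -> GRing.lreg s -> P = m.
Proof.
move=> [_ dimR] primeP Ps s_reg.
have [[idP NP1] PM] := primeP.
have NPM u u' : ~ P u -> ~ P u' -> ~ P (u * u') by move=> Nu Nu' /PM[].
(* The annihilator of t in the localization R_P, pulled back to R; [~ ann t 1] says that t is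
   nonzero there. *)
pose ann t := [set r | exists2 u, ~ P u & r * u * t = 0].
have id_ann t : is_ideal setT (ann t).
  split=> // [|x y [u Nu xu] [u' Nu' yu']|a x _ [u Nu xu]].
  - by exists 1; rewrite ?mul0r.
  - exists (u * u'); first exact: NPM.
    have -> : (x + y) * (u * u') * t = u' * (x * u * t) + u * (y * u' * t) by ring.
    by rewrite xu yu' !mulr0 addr0.
  - exists u => //; have -> : a * x * u * t = a * (x * u * t) by ring.
    by rewrite xu mulr0.
have [||_ [t Nt1 <-] maxt] :=
    @noetherian_maximal [set ann t | t in [set t | ~ ann t 1]] noethR.
- by move=> _ [t _ <-].
- exists (ann 1), 1 => // -[u Nu]; rewrite mul1r mulr1 => u0; apply: Nu.
  by rewrite u0; case: idP.
have annM u : ~ ann t u -> ann (u * t) `<=` ann t.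
  move=> Nu; apply: maxt.
    exists (u * t) => // -[u' Nu' e]; apply: Nu; exists u' => //.
    by rewrite -e; ring.
  move=> r [u' Nu' e]; exists u' => //.
  have -> : r * u' * (u * t) = u * (r * u' * t) by ring.
  by rewrite e mulr0.
have prime_ann : prime_ideal (ann t).
  split; first by split.
  move=> x y [u Nu e]; have [?|Ny] := pselect (ann t y); first by right.
  left; apply: annM Ny _ _; exists u => //; rewrite -e; ring.
have annP : ann t `<=` P.
  move=> r [u Nu e]; apply: contrapT => NPr; apply: Nt1.
  by exists (r * u); rewrite ?mul1r //; exact: NPM.
have Nann_s : ~ ann t s.
  move=> [u Nu e]; apply: Nt1; exists u => //; apply: s_reg.
  by rewrite mulr0 -e; ring.
have Pm : P `<=` m by exact: proper_sub_maximal.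
apply/seteqP; split=> // x mx; apply: contrapT => NPx.
suff /dimR : prime_chain R 2 by [].
exists (fun i => match i with 0%N => ann t | 1%N => P | _ => m end); split.
- move=> [|[|i]] // _; split; first by case: localR => [[]].
  move=> a b mab; apply: contrapT => /not_orP[/local_invP[a' aa']] /local_invP[b' bb'].
  apply: local_maximal_proper.
  have <- : a' * b' * (a * b) = 1.
    by rewrite mulrACA (mulrC a') aa' (mulrC b') bb' mulr1.
  by case: local_maximal_ideal => _ _ _; apply.
- move=> [|[|i]] // _; split=> //.
  + by move=> /(_ s Ps).
  + by move=> /(_ x mx).
Qed.

(** A maximal colon ideal (J : z) with z outside J is prime and contains the regular element s, so
    it equals m. *)
Lemma socle_element s J : krull_dim R 1 -> GRing.lreg s ->
    is_ideal setT J -> J s -> ~ J 1 ->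
  exists2 z, ~ J z & forall r, m r -> J (r * z).
Proof.
move=> dimR s_reg idJ Js NJ1; have [_ J0 JD JM] := idJ.
pose colon t := [set r | J (r * t)].
have id_colon t : is_ideal setT (colon t).
  split=> //; rewrite /colon /=.
  - by rewrite mul0r.
  - by move=> x y Jx Jy; rewrite mulrDl; apply: JD.
  - by move=> a x _ Jx; rewrite -mulrA; apply: JM.
have [||_ [z Nz <-] maxz] :=
    @noetherian_maximal [set colon t | t in [set t | ~ J t]] noethR.
- by move=> _ [t _ <-].
- by exists (colon 1), 1.
exists z => // r; suff <- : colon z = m by [].
apply: (prime_lreg_maximal dimR) s_reg => //; last first.
  by rewrite /colon /= mulrC; apply: JM.
split; first by split=> //; rewrite /colon /= mul1r.
move=> x y xy; have [?|Ny] := pselect (colon z y); first by right.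
left; apply: (maxz (colon (y * z))).
- by exists (y * z).
- move=> t zt; rewrite /colon /= mulrCA; exact: JM.
- by rewrite /colon /= mulrA.
Qed.

(** For an ideal J this is the descending chain condition of the ring R / J. *)
Definition dcc_above J := forall c : nat -> set R,
  (forall n, is_ideal setT (c n)) -> (forall n, J `<=` c n) ->
  (forall n, c n.+1 `<=` c n) -> exists N, forall n, c N `<=` c n.

Lemma chain_le (c : nat -> set R) k n :
  (forall n, c n.+1 `<=` c n) -> (k <= n)%N -> c n `<=` c k.
Proof.
move=> c_le; elim: n => [|n IH]; first by rewrite leqn0 => /eqP ->.
rewrite leq_eqVlt ltnS => /predU1P[->//|/IH]; exact: subset_trans.
Qed.

(* Noetherian induction: a maximal counterexample J has a socle element z
   modulo J, and a chain above J is controlled by its sum with Rz (dcc above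
   J + Rz) and by whether it contains z. *)
Lemma lreg_dcc s J : krull_dim R 1 -> GRing.lreg s ->
  is_ideal setT J -> J s -> dcc_above J.
Proof.
move=> dimR s_reg idJ Js; apply: contrapT => NJ.
have [||{NJ Js}J [{}idJ Js NJ] maxJ] := @noetherian_maximal
  [set J | [/\ is_ideal setT J, J s & ~ dcc_above J]] noethR.
- by move=> I [].
- by exists J.
have [_ J0 JD JM] := idJ; apply: NJ => c idc Jc c_le.
have [J1|NJ1] := pselect (J 1).
  exists 0%N => n x _; apply: Jc; rewrite -(mulr1 x); exact: JM.
have [z Nz mz] := socle_element dimR s_reg idJ Js NJ1.
pose plus I := [set y | exists2 x, I x & exists r, y = x + r * z].
have id_plus I : is_ideal setT I -> is_ideal setT (plus I).
  case=> _ I0 ID IM; split=> //.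
  - by exists 0 => //; exists 0; rewrite mul0r addr0.
  - move=> _ _ [x Ix [r ->]] [x' Ix' [r' ->]]; exists (x + x'); first exact: ID.
    by exists (r + r'); ring.
  - move=> a _ _ [x Ix [r ->]]; exists (a * x); first exact: IM.
    by exists (a * r); ring.
have sub_plus I : I `<=` plus I.
  by move=> x Ix; exists x => //; exists 0; rewrite mul0r addr0.
have dcc_plus : dcc_above (plus J).
  apply: contrapT => Nplus; apply: Nz; apply: (maxJ (plus J)) => //.
    by split; [exact: id_plus | exact: sub_plus |].
  by exists 0 => //; exists 1; rewrite add0r mul1r.
have [|||N stabN] := dcc_plus (fun n => plus (c n)).
- by move=> n; exact: id_plus.
- by move=> n _ [x Jx [r ->]]; exists x; [exact: Jc | exists r].
- by move=> n _ [x cx [r ->]]; exists x; [exact: c_le | exists r].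
(* Either z never leaves the chain, or M is a stage that misses it. *)
have [M stabM] : exists M, c M z -> forall n, c n z.
  have [cz|/existsNP[M NM]] := pselect (forall n, c n z); first by exists 0%N.
  by exists M => /NM.
exists (maxn N M) => n y cy.
pose k := maxn n (maxn N M).
have [x' cx' [r' yx']] := stabN k y (sub_plus _ _ (chain_le c_le (leq_maxl N M) cy)).
have [_ _ cD cM] := idc n; have ckn := chain_le c_le (leq_maxl n (maxn N M)).
rewrite yx'; apply: cD; first exact: ckn.
have : c (maxn N M) (r' * z).
  rewrite (_ : r' * z = y - x'); last by rewrite yx' addrAC subrr add0r.
  apply: is_idealB => //; exact: chain_le c_le (leq_maxr n (maxn N M)) _ cx'.
(* If [r'] is in m, then [r' * z] falls into J; otherwise z itself lies in the chain at stage max(N,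
   M), hence at every stage. *)
have [mr' _|/local_inv[u ru] crz] := pselect (m r'); first by apply: Jc; exact: mz.
apply: cM => //; apply: stabM.
apply: (chain_le c_le (leq_maxr N M)).
rewrite -(mul1r z) -ru (mulrC r') -mulrA.
by have [_ _ _] := idc (maxn N M); apply.
Qed.

End Local.

(** The dimension is unique, so the depth is 1. The single term of a regular sequence of that length
    is regular modulo the ideal generated by the empty sequence, which is zero. *)
Lemma cohen_macaulay_lreg (m : set R) : krull_dim R 1 -> cohen_macaulay m ->
  exists2 y, m y & GRing.lreg y.
Proof.
move=> [chain1 dim1] [d [chaind dimd] [[s [sm s_reg] size_s] _]].
have size1 : size s = 1%N.
  by apply/eqP; rewrite size_s eqn_leq dim1 // dimd.
case: s size1 sm s_reg {size_s} => [|y []] //= _ sm s_reg.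
exists y; first by apply: sm; rewrite /= mem_head.
move=> a b yab; apply/eqP; rewrite -subr_eq0; apply/eqP.
have id0 : is_ideal setT [set 0 : R].
  split=> // [_ _ -> ->|c _ _ ->]; first by rewrite addr0.
  by rewrite mulr0.
have : gen_ideal [set` take 0 [:: y]] (a - b).
  apply: s_reg => // I [[_ I0 _ _] _].
  by rewrite /= mulrBr yab subrr.
by move/(_ [set 0]); apply; split=> // z /=; rewrite in_nil.
Qed.

End Noetherian.

(** * Horner truncations of polynomials *)

Lemma drop_polyS (A : nzRingType) (F : {poly A}) k :
  drop_poly k F = drop_poly k.+1 F * 'X + (F`_k)%:P.
Proof.
apply/polyP => i; rewrite coefD coefMX coefC !coef_drop_poly.
by case: i => [|i]; rewrite ?add0r // addr0 addnS.
Qed.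

Lemma horner_map_drop_poly (A B : nzRingType) (f : {rmorphism A -> B})
    (F : {poly A}) k (x : B) :
  (map_poly f (drop_poly k F)).[x]
    = (map_poly f (drop_poly k.+1 F)).[x] * x + f F`_k.
Proof.
by rewrite drop_polyS rmorphD rmorphM /= map_polyX map_polyC hornerMXaddC.
Qed.

Lemma monic_drop_poly1 (A : nzRingType) (F : {poly A}) d :
  F \is monic -> size F = d.+2 -> drop_poly 1 F \is monic.
Proof.
move=> + sizeF; rewrite !monicE /lead_coef size_drop_poly coef_drop_poly sizeF.
by rewrite subn1 addn1.
Qed.

(** * Polynomial relations and units in the total ring of fractions *)

Section TotalFractions.
Variables (R : comNzRingType) (m : set R).
Variables (K : comUnitRingType) (iota : {rmorphism R -> K}).
Hypotheses (noethR : noetherian R) (localR : local_ring m).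
Hypotheses (dimR : krull_dim R 1) (fracK : total_fractions iota).

Local Notation "p ^:K" := (map_poly iota p) (at level 2, format "p ^:K").

Lemma fraction_inj : injective iota. Proof. by case: fracK. Qed.

Lemma fraction_unit s : GRing.lreg s -> iota s \is a GRing.unit.
Proof. by case: fracK => _ + _; apply. Qed.

(** The numerator of a regular fraction is regular in R, hence becomes a unit of K. *)
Lemma lreg_fraction_unit (x : K) : GRing.lreg x -> x \is a GRing.unit.
Proof.
move=> x_reg; have [_ _ /(_ x)[a [s [s_reg xE]]]] := fracK.
have us := fraction_unit s_reg.
rewrite xE unitrM unitrV us andbT; apply: fraction_unit => b c abc.
apply: fraction_inj; apply: (mulrI us); apply: x_reg.
have xs : x * iota s = iota a by rewrite xE divrK.
by rewrite !mulrA xs -!rmorphM abc.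
Qed.

(** Write x = a / s; multiplying a and s by y puts s in m. Chain conditions give s^N x^n = e +
    s^(N+1) G(x) with e in R equal to s^N H(x) for some H of degree below n. Cancelling s^N leaves
    x^n - s G(x) - H(x) = 0, whose coefficient of index n is 1 - s G_n, outside m. *)
Lemma relation_with_unit_coef y (x : K) : m y -> GRing.lreg y ->
  exists F k, F^:K.[x] = 0 /\ ~ m F`_k.
Proof.
move=> my y_reg.
have [a [s [s_reg ms xE]]] :
    exists a s, [/\ GRing.lreg s, m s & x * iota s = iota a].
  have [_ _ /(_ x)[a [s [s_reg xE]]]] := fracK.
  exists (a * y), (s * y); split; first exact: lregM.
    by case: (local_maximal_ideal localR) => _ _ _; apply.
  by rewrite !rmorphM mulrA xE divrK // fraction_unit.
have us := fraction_unit s_reg.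
(* The traces on R of s^h R[x] + sR; by dcc they stabilise. *)
pose J h := [set r | exists F e,
  iota r = iota s ^+ h * F^:K.[x] + iota s * iota e].
have idJ h : is_ideal setT (J h).
  split=> //.
  - by exists 0, 0; rewrite !rmorph0 horner0 !mulr0 addr0.
  - move=> r r' [F [e re]] [F' [e' re']]; exists (F + F'), (e + e').
    by rewrite !rmorphD hornerD re re' /=; ring.
  - move=> b r _ [F [e re]]; exists (b *: F), (b * e).
    by rewrite !rmorphM map_polyZ hornerZ re /=; ring.
have J_le h : J h.+1 `<=` J h.
  move=> r [F [e re]]; exists (s *: F), e.
  by rewrite re map_polyZ hornerZ exprSr mulrA.
have id_sR : is_ideal setT (range ( *%R s)).
  split=> // [|_ _ [b _ <-] [c _ <-]|c _ _ [b _ <-]].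
  - by exists 0; rewrite ?mulr0.
  - by exists (b + c); rewrite ?mulrDr.
  - by exists (c * b); rewrite // mulrCA.
have [||N stabN] := lreg_dcc noethR localR dimR s_reg id_sR _ idJ _ J_le.
- by exists 1; rewrite ?mulr1.
- move=> h _ [e _ <-]; exists 0, e.
  by rewrite rmorphM rmorph0 horner0 mulr0 add0r.
(* This puts s^N R[x] inside R + s^(N+1) R[x]; the induction is on a power of s that clears the
   denominator of F(x). *)
have denominators h F : (exists r, iota s ^+ h * F^:K.[x] = iota r) ->
    exists e G, iota s ^+ N * F^:K.[x] = iota e + iota s ^+ N.+1 * G^:K.[x].
  elim: h F => [|h IH] F [r rE].
    rewrite expr0 mul1r in rE; exists (s ^+ N * r), 0.
    by rewrite rE rmorphM rmorphXn rmorph0 horner0 mulr0 addr0.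
  have [Nh|hN] := leqP N h.+1.
    have [G [e re]] : J h.+2 r.
      apply: stabN; apply: (chain_le J_le Nh); exists F, 0.
      by rewrite rE rmorph0 mulr0 addr0.
    have [|e' [G' eG']] := IH (F - s *: G).
      exists e; apply: (mulrI us).
      rewrite rmorphB /= hornerD hornerN map_polyZ hornerZ mulrA -exprS mulrBr rE re.
      by rewrite mulrA -exprSr addrAC subrr add0r.
    exists e', (G' + G); rewrite rmorphD hornerD mulrDr addrA -eG'.
    rewrite rmorphB /= hornerD hornerN map_polyZ hornerZ mulrBr mulrA -exprSr.
    by rewrite subrK.
  exists (s ^+ (N - h.+1) * r), 0.
  rewrite rmorphM rmorphXn rmorph0 horner0 mulr0 addr0 -rE mulrA -exprD.
  by rewrite subnK // ltnW.
(* The elements of R in s^N R[x], filtered by degree; the index where the filtration stabilises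
   serves as n. *)
pose W n := [set r | exists2 H : {poly R},
  (size H <= n)%N & iota r = iota s ^+ N * H^:K.[x]].
have [||n stabW] := noetherian_chain (c := W) noethR.
- move=> n; split=> //.
  + by exists 0; rewrite ?size_poly0 // !rmorph0 horner0 mulr0.
  + move=> r r' [H nH rH] [H' nH' rH']; exists (H + H').
      by rewrite (leq_trans (size_polyD _ _)) // geq_max nH.
    by rewrite !rmorphD hornerD rH rH' mulrDr.
  + move=> b r _ [H nH rH]; exists (b *: H).
      by rewrite (leq_trans (size_scale_leq _ _)).
    by rewrite rmorphM map_polyZ hornerZ rH mulrCA.
- by move=> n r [H nH rH]; exists H => //; exact: leqW.
have [|e [G eG]] := denominators n 'X^n.
  exists (a ^+ n).
  by rewrite map_polyXn hornerXn rmorphXn -exprMn mulrC xE.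
have [H nH eH] : W n e.
  apply: (stabW (size ('X^n - s *: G))); exists ('X^n - s *: G) => //.
  rewrite rmorphB /= hornerD hornerN map_polyZ hornerZ mulrBr eG mulrA -exprSr.
  by rewrite addrK.
exists ('X^n - s *: G - H), n; split.
  apply: (mulrI (unitrX N us)); rewrite mulr0.
  rewrite 2!rmorphB /= 2!hornerD !hornerN map_polyZ hornerZ 2!mulrBr -eH eG mulrA.
  by rewrite -exprSr addrK subrr.
rewrite !coefB coefXn eqxx coefZ (nth_default _ nH) subr0 => m1.
apply: (local_maximal_proper localR); rewrite -(subrK (s * G`_n) 1).
have [_ _ mD mM] := local_maximal_ideal localR.
by apply: mD => //; rewrite mulrC; apply: mM.
Qed.

(** Multiplied by u^(k-1), the relation becomes monic in u x, with coefficients F_j u^(k-1-j)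
    integral over R. For k = 0 it forces u = 0. *)
Lemma integral_mul_root (x u : K) (F : {poly R}) k : integralOver iota u ->
  (size F <= k)%N -> u * x ^+ k + F^:K.[x] = 0 -> integralOver iota (u * x).
Proof.
move=> intu; case: k => [|k] Fk.
  move: Fk; rewrite leqn0 size_poly_eq0 => /eqP ->.
  rewrite mulr1 rmorph0 horner0 addr0 => ->; rewrite mul0r; exact: integral0.
move=> ux; pose L := \poly_(j < k.+1) (iota F`_j * u ^+ (k - j)).
have sizeL : (size L < size ('X^(k.+1) : {poly K}))%N.
  by rewrite size_polyXn ltnS size_poly.
apply: (@integral_root_monic _ _ _ _ ('X^(k.+1) + L)).
- by rewrite monicE lead_coefDl // lead_coefXn.
- rewrite /root hornerD hornerXn horner_poly.
  suff -> : \sum_(i < k.+1) iota F`_i * u ^+ (k - i) * (u * x) ^+ i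
          = u ^+ k * F^:K.[x].
    by rewrite exprMn exprSr -mulrA -mulrDr ux mulr0.
  rewrite (@horner_coef_wide _ k.+1) ?(leq_trans (size_poly _ _) Fk) //.
  rewrite mulr_sumr; apply: eq_bigr => i _; rewrite coef_map /= exprMn.
  have -> : u ^+ k = u ^+ (k - i) * u ^+ i by rewrite -exprD subnK ?leq_ord.
  by rewrite [RHS]mulrACA [_ * iota _]mulrC.
- apply/(integral_poly iota) => j; rewrite coefD coefXn coef_poly.
  apply: integral_add; first exact: integral_nat.
  case: ifP => _; last exact: integral0.
  apply: integral_mul; first exact: integral_id.
  elim: (k - j)%N => [|i IH]; first exact: integral1.
  by rewrite exprS; exact: integral_mul.
Qed.

(* With b_k = sum_(j >= k) F`_j x^(j - k), both b_k and b_k x are integral,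
   and F`_k = b_k - b_(k+1) x. *)
Lemma integral_drop_poly (x : K) (F : {poly R}) k : F^:K.[x] = 0 ->
  integralOver iota (drop_poly k F)^:K.[x] /\
  integralOver iota ((drop_poly k F)^:K.[x] * x).
Proof.
move=> Fx.
have step j : integralOver iota (drop_poly j F)^:K.[x] ->
    integralOver iota ((drop_poly j F)^:K.[x] * x).
  (* Since F(x) = 0, b_j x^j is minus the value at x of the part of F below degree j. *)
  move=> intb; apply: (integral_mul_root (F := take_poly j F) (k := j) intb).
    exact: size_take_poly.
  rewrite -hornerXn -hornerM -(map_polyXn iota) -rmorphM -hornerD -rmorphD.
  by rewrite addrC poly_take_drop.
suff intb : integralOver iota (drop_poly k F)^:K.[x] by split=> //; exact: step.
have [Fk|/ltnW kF] := leqP (size F) k.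
  by rewrite drop_poly_eq0 // rmorph0 horner0; exact: integral0.
(* Descending induction on k, from the size of F, where the truncation vanishes. *)
rewrite -(subKn kF); elim: (_ - k)%N => [|j IH].
  by rewrite subn0 drop_poly_eq0 // rmorph0 horner0; exact: integral0.
have [Fj|jF] := leqP (size F) j.
  by move: IH; rewrite (eqP Fj) (eqP (leqW Fj)).
rewrite horner_map_drop_poly -subSn // subSS.
by apply: integral_add; [exact: step | exact: integral_id].
Qed.

(** The annihilators in R of the products [P k] of successive translates stabilise at some k. If the
    translate by y^(N+k) kills z, then so does [P k]; but w acts on z as -y^(N+k), so [P k] acts on
    z as the regular element [D k], and z = 0. *)
Lemma exists_unit_translate y (w : K) N : m y -> GRing.lreg y ->
  exists2 n, (N <= n)%N & w + iota y ^+ n \is a GRing.unit.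
Proof.
move=> my y_reg; apply: contrapT => none.
pose P k := \prod_(i < k) (w + iota y ^+ (N + i)).
pose c k := [set z : R | P k * iota z = 0].
have [||k stabc] := noetherian_chain (c := c) noethR.
- move=> k; split=> //.
  + by rewrite /c /= rmorph0 mulr0.
  + by move=> z z' cz cz'; rewrite /c /= rmorphD mulrDr cz cz' addr0.
  + by move=> b z _ cz; rewrite /c /= rmorphM mulrCA cz mulr0.
- by move=> k z cz; rewrite /c /= /P big_ord_recr /= mulrAC cz mul0r.
apply: none; exists (N + k)%N; first exact: leq_addr.
apply: lreg_fraction_unit => b1 b2 /eqP; rewrite -subr_eq0 -mulrBr => /eqP wb.
apply/eqP; rewrite -subr_eq0; apply/eqP; move: (b1 - b2) wb => b wb {b1 b2}.
have [_ _ /(_ b)[z [s [s_reg bE]]]] := fracK.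
have us := fraction_unit s_reg.
have {wb} wz : (w + iota y ^+ (N + k)) * iota z = 0.
  have -> : iota z = b * iota s by rewrite bE divrK.
  by rewrite mulrA wb mul0r.
suff z0 : z = 0 by rewrite bE z0 rmorph0 mul0r.
have : P k * iota z = 0.
  apply: (stabc k.+1); rewrite /c /= /P big_ord_recr /= -mulrA wz mulr0 //.
pose D j := \prod_(i < j) (y ^+ (N + i) - y ^+ (N + k)).
have -> : P k * iota z = iota (D k * z).
  suff PD j : P j * iota z = iota (D j * z) by exact: PD.
  rewrite /P /D; elim: j => [|j IH]; first by rewrite !big_ord0 !mul1r.
  move/eqP: wz; rewrite mulrDl addr_eq0 => /eqP wz.
  have wzj : (w + iota y ^+ (N + j)) * iota z
      = iota (y ^+ (N + j) - y ^+ (N + k)) * iota z.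
    by rewrite mulrDl wz rmorphB mulrBl !rmorphXn addrC.
  by rewrite !big_ord_recr /= -mulrA wzj mulrCA IH -rmorphM mulrCA mulrA.
have D_reg : GRing.lreg (D k).
  rewrite /D; elim/big_ind: _ => [|? ?|i _]; [exact: lreg1 | exact: lregM |].
  have -> : y ^+ (N + i) - y ^+ (N + k) = y ^+ (N + i) * (1 - y ^+ (k - i)).
    by rewrite mulrBr mulr1 -exprD -addnA subnKC // ltnW.
  apply: lregM; first exact: lregX.
  apply: (lreg_sub1 noethR localR).
  have -> : (k - i = (k - i).-1.+1)%N by rewrite prednK // subn_gt0.
  by rewrite exprSr; case: (local_maximal_ideal localR) => _ _ _; apply.
by rewrite -(rmorph0 iota) => /fraction_inj Dz; apply: D_reg; rewrite mulr0.
Qed.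

End TotalFractions.

(** * Elementary properties of discrete valuations *)

Section DiscreteValuation.
Variables (K : comUnitRingType) (nu : K -> \bar int).
Hypothesis valnu : discrete_valuation nu.

Lemma valuationM x y : nu (x * y) = (nu x + nu y)%E.
Proof. by case: valnu. Qed.

Lemma valuation_neq_ninfty x : nu x != -oo%E.
Proof.
case: valnu => rnu _ _ _; have : range nu (nu x) by exists x.
by rewrite rnu.
Qed.

Lemma valuation_surj (n : int) : exists x, nu x = n%:E.
Proof.
case: valnu => rnu _ _ _; have : range nu n%:E by rewrite rnu.
by case=> x _; exists x.
Qed.

Lemma valuation1 : nu 1 = 0%E.
Proof.
have [x nux] := valuation_surj 0.
have := valuationM x 1; rewrite mulr1 nux.
have := valuation_neq_ninfty 1.
by case: (nu 1) => [n||] // _; rewrite add0e.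
Qed.

Lemma valuation_unit u : u \is a GRing.unit -> exists n : int, nu u = n%:E.
Proof.
move=> uu; have := valuationM u u^-1; rewrite mulrV // valuation1.
have := valuation_neq_ninfty u; have := valuation_neq_ninfty u^-1.
by case: (nu u) => [n _ _ _||]; [exists n | case: (nu u^-1) |].
Qed.

Lemma valuationN x : nu (- x) = nu x.
Proof.
rewrite -mulN1r valuationM.
have [n nuN1] : exists n : int, nu (-1) = n%:E.
  by apply: valuation_unit; rewrite unitrN unitr1.
have := valuationM (-1) (-1); rewrite mulrNN mulr1 valuation1 nuN1 => -[n0].
have -> : n = 0 by lia.
by rewrite add0e.
Qed.

Lemma le_valuationD c x y : (c <= nu x)%E -> (c <= nu y)%E -> (c <= nu (x + y))%E.
Proof.
case: valnu => _ _ _ /(_ x y) nuD cx cy.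
by apply: le_trans nuD; rewrite le_min cx.
Qed.

Lemma lt_valuationD c x y : (c < nu x)%E -> (c < nu y)%E -> (c < nu (x + y))%E.
Proof.
case: valnu => _ _ _ /(_ x y) nuD cx cy.
by apply: lt_le_trans nuD; rewrite lt_min cx.
Qed.

Lemma lt_valuationB c x y : (c < nu x)%E -> (c < nu y)%E -> (c < nu (x - y))%E.
Proof. by move=> cx cy; apply: lt_valuationD; rewrite ?valuationN. Qed.

Lemma valuationDl x y : (nu x < nu y)%E -> nu (x + y) = nu x.
Proof.
move=> xy; apply/eqP; rewrite eq_le le_valuationD ?(ltW xy) // andbT leNgt.
by apply/negP => lt_x; have := lt_valuationB lt_x xy; rewrite addrK ltxx.
Qed.

Lemma valuationX x (a : int) n : nu x = a%:E -> nu (x ^+ n) = (a *+ n)%:E.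
Proof.
move=> nux; elim: n => [|n IH]; first by rewrite expr0 valuation1.
by rewrite exprS valuationM nux IH mulrS.
Qed.

Lemma valuation0 : nu 0 = +oo%E. Proof. by case: valnu. Qed.

Lemma valuation_pos0 : (0 < nu 0)%E. Proof. by rewrite valuation0. Qed.

End DiscreteValuation.

(** * Center and residues of a valuation nonnegative on R *)

Section Center.
Variables (R : comNzRingType) (m : set R).
Variables (K : comUnitRingType) (iota : {rmorphism R -> K}).
Hypotheses (noethR : noetherian R) (localR : local_ring m).
Hypotheses (dimR : krull_dim R 1) (fracK : total_fractions iota).
Variable nu : K -> \bar int.
Hypotheses (valnu : discrete_valuation nu).
Hypothesis (nu_iota : forall r, (0 <= nu (iota r))%E).

Local Notation "p ^:K" := (map_poly iota p) (at level 2, format "p ^:K").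

(** The elements of R of positive value form a prime ideal. It contains a regular element, the
    denominator of a fraction of value -1, so it is m. *)
Lemma center_maximal r : (0 < nu (iota r))%E <-> m r.
Proof.
suff <- : [set r | (0 < nu (iota r))%E] = m by [].
have [s [s_reg s_pos]] : exists s, GRing.lreg s /\ (0 < nu (iota s))%E.
  have [x nux] := valuation_surj valnu (-1).
  have [_ _ /(_ x)[a [s [s_reg xE]]]] := fracK.
  exists s; split=> //; have us := fraction_unit fracK s_reg.
  have [n nus] := valuation_unit valnu us.
  have := valuationM valnu x (iota s); rewrite xE divrK // -xE nux nus.
  have := nu_iota a => + nua; rewrite nua !lee_fin lte_fin; lia.
apply: (prime_lreg_maximal noethR localR dimR) s_pos s_reg.
split; first split; first split=> //=.
- by rewrite rmorph0 valuation_pos0.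
- by move=> x y x0 y0; rewrite rmorphD lt_valuationD.
- move=> a x _ x0; rewrite rmorphM (valuationM valnu).
  exact: lte_paddl.
- by rewrite /= rmorph1 valuation1 // ltxx.
move=> x y /=; rewrite rmorphM (valuationM valnu) => xy.
have [?|x0] := ltP 0%E (nu (iota x)); [by left | right].
have -> : nu (iota y) = (nu (iota x) + nu (iota y))%E; last exact: xy.
by rewrite (_ : nu (iota x) = 0%E) ?add0e //; apply/eqP; rewrite eq_le x0 nu_iota.
Qed.

Lemma valuation_center r : ~ m r -> nu (iota r) = 0%E.
Proof.
move=> /center_maximal/negP; rewrite -leNgt => r0.
by apply/eqP; rewrite eq_le r0 nu_iota.
Qed.

(** If x had negative value n, the leading term would dominate at each Horner step, and a monic
    polynomial of degree d would take the finite value n d at x. *)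
Lemma valuation_integral x : integralOver iota x -> (0 <= nu x)%E.
Proof.
case=> F monF /rootP Fx; rewrite leNgt; apply/negP => x0.
have [n nux] : exists n : int, nu x = n%:E.
  move: x0; have := valuation_neq_ninfty valnu x.
  by case: (nu x) => [n||] //; exists n.
have n0 : n < 0 by move: x0; rewrite nux lte_fin.
have nuF d (G : {poly R}) : G \is monic -> size G = d.+1 ->
    nu G^:K.[x] = (n *+ d)%:E.
  elim: d G => [|d IH] G monG sizeG.
    have GE : G = 1.
      rewrite (size1_polyC (eq_leq sizeG)).
      by move/monicP: monG; rewrite /lead_coef sizeG => ->.
    by rewrite GE rmorph1 hornerC valuation1.
  have nuGx : nu ((drop_poly 1 G)^:K.[x] * x) = (n *+ d.+1)%:E.
    have sizeG1 : size (drop_poly 1 G) = d.+1 by rewrite size_drop_poly sizeG.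
    rewrite (valuationM valnu) nux (IH _ (monic_drop_poly1 monG sizeG) sizeG1).
    by rewrite mulrSr.
  rewrite -[G]drop_poly0l horner_map_drop_poly (valuationDl valnu).
    exact: nuGx.
  rewrite nuGx; apply: lt_le_trans (nu_iota _).
  by rewrite lte_fin pmulrn_llt0.
have := nuF (size F).-1 F monF; rewrite Fx valuation0 //.
by rewrite prednK ?size_poly_gt0 ?monic_neq0 // => /(_ erefl).
Qed.

(** Suppose a larger ideal contains x of value 0, and take F monic of least degree with F(x) of
    positive value. Its constant term is outside m, since otherwise F could be divided by X. Being
    F(x) - G(x) x, this unit of R lies in the larger ideal. *)
Lemma center_integral_closure_maximal :
  maximal_ideal (integral_closure iota)
    [set x | integralOver iota x /\ (0 < nu x)%E].
Proof.
split; first split; first split.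
- by move=> x [].
- by split; [exact: integral0 | rewrite valuation_pos0].
- move=> x y [ix x0] [iy y0]; split; first exact: integral_add.
  exact: lt_valuationD.
- move=> a x ia [ix x0]; split; first exact: integral_mul.
  by rewrite (valuationM valnu) lte_paddl // valuation_integral.
- by move=> [_]; rewrite valuation1 // ltxx.
move=> n' [[n'A n'0 n'D n'M] Nn'1] nn'; apply/seteqP; split=> // x n'x.
have ix := n'A _ n'x; split=> //; apply: contrapT => /negP.
rewrite -leNgt => x_le0; apply: Nn'1.
have x0 : nu x = 0%E by apply/eqP; rewrite eq_le x_le0 valuation_integral.
have : exists d, `[< exists F : {poly R}, [/\ F \is monic, size F = d.+1 &
    (0 < nu F^:K.[x])%E] >].
  case: ix => F monF /rootP Fx; exists (size F).-1; apply/asboolP; exists F.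
  split=> //; first by rewrite prednK // size_poly_gt0 monic_neq0.
  by rewrite Fx valuation_pos0.
case/ex_minnP => d /asboolP[F [monF sizeF Fx]] d_min.
pose G := drop_poly 1 F.
have Fx_E : F^:K.[x] = G^:K.[x] * x + iota F`_0.
  by rewrite -horner_map_drop_poly drop_poly0l.
have NmF0 : ~ m F`_0.
  move=> /center_maximal F0_pos.
  have Gx : (0 < nu G^:K.[x])%E.
    have := lt_valuationB valnu Fx F0_pos.
    by rewrite Fx_E addrK (valuationM valnu) x0 adde0.
  case: d sizeF d_min => [|d] sizeF d_min.
    move/monicP: monF F0_pos; rewrite /lead_coef sizeF => ->.
    by rewrite rmorph1 valuation1 // ltxx.
  have : (d.+1 <= d)%N; last by rewrite ltnn.
  apply/d_min/asboolP; exists G; split=> //; last first.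
    by rewrite /G size_drop_poly sizeF.
  exact: monic_drop_poly1 sizeF.
have [c F0c] := local_inv noethR localR NmF0.
have F0_n' : n' (iota F`_0).
  have -> : iota F`_0 = F^:K.[x] + (- G^:K.[x]) * x.
    by rewrite Fx_E mulNr addrAC subrr add0r.
  have iF (H : {poly R}) : integralOver iota H^:K.[x].
    apply: integral_horner => //; apply/(integral_poly iota) => i.
    by rewrite coef_map; exact: integral_id.
  apply: n'D; first by apply: nn'; split.
  by apply: n'M => //; apply: integral_opp.
rewrite -(rmorph1 iota) -F0c rmorphM mulrC; apply: n'M => //.
exact: integral_id.
Qed.

Hypothesis residue_eq : forall n, maximal_ideal (integral_closure iota) n ->
  quotient_by (integral_closure iota) n = quotient_by (range iota) n.

Lemma integral_residue z : integralOver iota z ->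
  exists r, (0 < nu (z - iota r))%E.
Proof.
move=> iz; set n := [set x | integralOver iota x /\ (0 < nu x)%E].
have : quotient_by (integral_closure iota) n [set y | n (y - z)] by exists z.
rewrite residue_eq; last exact: center_integral_closure_maximal.
case=> _ [r _ <-] nE; exists r.
suff : [set y | n (y - iota r)] z by case.
rewrite nE /= subrr; split; [exact: integral0 | by rewrite valuation_pos0].
Qed.

Lemma valuation_residue y x : m y -> GRing.lreg y -> nu x = 0%E ->
  exists r, (0 < nu (x - iota r))%E.
Proof.
move=> my y_reg x0.
have [F [k [Fx NmFk]]] :=
  relation_with_unit_coef noethR localR dimR fracK x my y_reg.
have int_b j := integral_drop_poly j Fx.
(* If all truncations b_j had positive value at x, so would F_k = b_k - b_(k+1) x, although F_k is
   outside m. *)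
have [b [ib ibx b0]] : exists b,
    [/\ integralOver iota b, integralOver iota (b * x) & nu b = 0%E].
  apply: contrapT => none.
  have b_pos j : (0 < nu (drop_poly j F)^:K.[x])%E.
    have [ib ibx] := int_b j; rewrite lt_neqAle valuation_integral // andbT.
    by apply/eqP => b0; apply: none; exists (drop_poly j F)^:K.[x].
  apply: NmFk; apply/center_maximal.
  have := b_pos k; rewrite horner_map_drop_poly => bk_pos.
  have bkx_pos : (0 < nu ((drop_poly k.+1 F)^:K.[x] * x))%E.
    by rewrite (valuationM valnu) x0 adde0.
  by have := lt_valuationB valnu bk_pos bkx_pos; rewrite addrAC subrr add0r.
(* The residues of b x and b are lifted by [r1] and [r2], so r1 / r2 lifts that of x. *)
have [r1 r1E] := integral_residue ibx.
have [r2 r2E] := integral_residue ib.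
have [u r2u] : exists u, r2 * u = 1.
  apply: (local_inv noethR localR) => /center_maximal r2_pos.
  by have := lt_valuationD valnu r2E r2_pos; rewrite subrK b0 ltxx.
exists (r1 * u).
have -> : nu (x - iota (r1 * u)) = nu (b * (x - iota (r1 * u))).
  by rewrite (valuationM valnu) b0 add0e.
have -> : b * (x - iota (r1 * u))
    = (b * x - iota r1) - iota (r1 * u) * (b - iota r2).
  have -> : iota r1 = iota (r1 * u) * iota r2.
    by rewrite -rmorphM -mulrA (mulrC u) r2u mulr1.
  by ring.
by apply: lt_valuationB => //; rewrite (valuationM valnu) lte_paddl.
Qed.

End Center.

(** * Values of a fractional ideal: minima and exchange *)

Section FractionalIdealValues.
Variables (R : comNzRingType) (m : set R).
Variables (K : comUnitRingType) (iota : {rmorphism R -> K}).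
Hypotheses (noethR : noetherian R) (localR : local_ring m).
Hypotheses (dimR : krull_dim R 1) (fracK : total_fractions iota).
Variables (p : nat) (val : 'I_p -> K -> \bar int).
Hypotheses (valP : forall i, discrete_valuation (val i)).
Hypothesis (val_iota : forall i r, (0 <= val i (iota r))%E).
Variable I : set K.
Hypothesis I_frac : fractional_ideal iota I.
Variable y : R.
Hypotheses (my : m y) (y_reg : GRing.lreg y).

Lemma fractional_idealB g h : I g -> I h -> I (g - h).
Proof.
case: I_frac => [[_ ID IM] _ _] Ig Ih; apply: ID => //.
by rewrite -mulN1r -(rmorph1 iota) -rmorphN; apply: IM.
Qed.

(** Take g + y^n x0 with x0 regular in I. All values of y are positive, so a large n pushes those of
    y^n x0 above B, and some such n makes g / x0 + y^n a unit. *)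
Lemma perturb_to_unit g (B : int) : I g -> exists g', [/\ I g',
  g' \is a GRing.unit,
  forall i, (val i g <= B%:E)%E -> val i g' = val i g &
  forall i, (B%:E < val i g)%E -> (B%:E < val i g')%E].
Proof.
move=> Ig; have [[_ ID IM] [x0 Ix0 x0_reg] _] := I_frac.
have ux0 := lreg_fraction_unit fracK x0_reg.
have valy i : exists a : int, 0 < a /\ val i (iota y) = a%:E.
  have [a ya] := valuation_unit (valP i) (fraction_unit fracK y_reg).
  exists a; split=> //; rewrite -lte_fin -ya.
  exact/(center_maximal noethR localR dimR fracK (valP i) (val_iota i)).
have valx0 i := valuation_unit (valP i) ux0.
have {valy}[a /all_and2[a0 ya]] := choice valy.
have {valx0}[c x0c] := choice valx0.
(* Since [a i] is at least 1, n >= |B| + |c_i| + 1 gives n a_i + c_i > B. *)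
pose N := (\sum_i (`|B| + `|c i|).+1)%N.
have [n Nn un] :=
  exists_unit_translate noethR localR fracK (g / x0) N my y_reg.
have big i : (B%:E < val i (iota (y ^+ n)%R * x0))%E.
  have cN : ((`|B| + `|c i|).+1 <= N)%N by rewrite /N (bigD1 i) //= leq_addr.
  rewrite (valuationM (valP i)) rmorphXn (valuationX (valP i) n (ya i)) x0c.
  rewrite lte_fin -mulr_natr; have := a0 i; nia.
exists (g + iota (y ^+ n) * x0); split.
- by apply: ID => //; exact: IM.
- have -> : g + iota (y ^+ n) * x0 = (g / x0 + iota y ^+ n) * x0.
    by rewrite mulrDl divrK // rmorphXn.
  by rewrite unitrM un.
- by move=> i gB; apply: (valuationDl (valP i)); exact: le_lt_trans (big i).
- by move=> i gB; apply: (lt_valuationD (valP i)).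
Qed.

Lemma valuesP g : I g -> g \is a GRing.unit ->
  exists2 c, values val I c & forall i, val i g = (c i)%:E.
Proof.
move=> Ig ug; have [c gc] := choice (fun i => valuation_unit (valP i) ug).
exists [ffun i => c i] => [|i]; last by rewrite ffunE.
by exists g => //; split=> [|i]; [exact: mulrI | rewrite ffunE].
Qed.

Lemma upper_bound_ffun (a b : {ffun 'I_p -> int}) :
  exists B : int, forall i, a i <= B /\ b i <= B.
Proof.
exists (\sum_i (`|a i| + `|b i|)%N)%:Z => i.
have : (`|a i| + `|b i| <= \sum_i (`|a i| + `|b i|))%N.
  by rewrite (bigD1 i) //= leq_addr.
by lia.
Qed.

(* Among the p + 1 elements h and g + r_j h of the pencil, each valuation
   excludes at most one. *)
Lemma values_min_closed (r : 'I_p -> R) :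
  (forall i j, i != j -> ~ m (r i - r j)) -> min_closed (values val I).
Proof.
move=> rP a b [g Ig [g_reg ga]] [h Ih [h_reg hb]].
have [[_ ID IM] _ _] := I_frac.
pose mu i : int := Order.min (a i) (b i).
have hmu i : ((mu i)%:E <= val i h)%E by rewrite hb lee_fin ge_min lexx orbT.
have gmu i : ((mu i)%:E <= val i g)%E by rewrite ga lee_fin ge_min lexx.
have not_both i : ((mu i)%:E < val i h)%E -> ((mu i)%:E < val i g)%E -> False.
  by rewrite hb ga !lte_fin /mu; lia.
(* The type [option 'I_p] indexes the p + 1 members of the pencil, with [None] for h. *)
pose f (o : option 'I_p) := if o is Some j then g + iota (r j) * h else h.
have lt_scale i s : ((mu i)%:E < val i h)%E -> ((mu i)%:E < val i (iota s * h))%E.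
  by move=> lt_h; rewrite (valuationM (valP i)) lte_paddl.
have [o fo] : exists o, forall i, val i (f o) = (mu i)%:E.
  apply: contrapT => none.
  have bad o : exists i, ((mu i)%:E < val i (f o))%E.
    apply: contrapT => Nbad; apply: none; exists o => i; apply/eqP.
    rewrite eq_le; apply/andP; split.
      by rewrite leNgt; apply/negP => bad; apply: Nbad; exists i.
    case: o {Nbad} => [j|] //=; apply: (le_valuationD (valP i)) => //.
    by rewrite (valuationM (valP i)) lee_paddl.
  have [ex exP] := choice bad.
  (* Two members spoiled at the same index differ by h times an element outside m, or one of them is
     h. Either way h, and then g, exceeds the minimum there. *)
  suff /leq_card : injective ex by rewrite card_option card_ord ltnn.
  move=> [j|] [k|] // e.
  - have [-> //|jk] := eqVneq j k.
    have := exP (Some j); rewrite e => fj; have fk := exP (Some k); exfalso.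
    have lt_h : ((mu (ex (Some k)))%:E < val (ex (Some k)) h)%E.
      have := lt_valuationB (valP _) fj fk.
      have -> : f (Some j) - f (Some k) = iota (r j - r k) * h.
        by rewrite /f rmorphB; ring.
      rewrite (valuationM (valP _)) (valuation_center noethR localR dimR fracK
        (valP _) (val_iota _) (rP _ _ jk)).
      by rewrite add0e.
    apply: (not_both _ lt_h).
    by have := lt_valuationB (valP _) fk (lt_scale _ (r k) lt_h); rewrite addrK.
  - have := exP (Some j); rewrite e => fj; have fN := exP None; exfalso.
    apply: (not_both _ fN).
    by have := lt_valuationB (valP _) fj (lt_scale _ (r j) fN); rewrite addrK.
  - have := exP None; rewrite e => fN; have fk := exP (Some k); exfalso.
    apply: (not_both _ fN).
    by have := lt_valuationB (valP _) fk (lt_scale _ (r k) fN); rewrite addrK.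
have If : I (f o) by case: (o) => [j|] //=; apply: ID => //; exact: IM.
(* The perturbation supplies regularity; as B bounds a and b, it keeps the values of [f o]. *)
have [B aB] := upper_bound_ffun a b.
have [g' [Ig' ug' g'f _]] := perturb_to_unit B If.
exists g' => //; split=> [|i]; first exact: mulrI.
rewrite g'f fo ?ffunE // lee_fin; have := aB i; rewrite /mu; lia.
Qed.

Hypothesis residue_eq : forall n, maximal_ideal (integral_closure iota) n ->
  quotient_by (integral_closure iota) n = quotient_by (range iota) n.

(** The witness is a perturbation of g - s h, where s in R lifts the residue of g / h at i. As s is
    outside m, s h has the same values as h. *)
Lemma values_exchange : exchange (values val I).
Proof.
move=> a b i [g Ig [g_reg ga]] [h Ih [h_reg hb]] abi.
have [[_ ID IM] _ _] := I_frac.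
have uh := lreg_fraction_unit fracK h_reg.
have ghK : g / h * h = g by rewrite divrK.
have gh0 : val i (g / h) = 0%E.
  have := valuationM (valP i) (g / h) h; rewrite ghK ga hb abi.
  have := valuation_neq_ninfty (valP i) (g / h).
  by case: (val i _) => [n||] // _ [n0]; congr _%:E; lia.
have [s s_pos] := valuation_residue noethR localR dimR fracK (valP i)
  (val_iota i) residue_eq my y_reg gh0.
have Nms : ~ m s.
  move/(center_maximal noethR localR dimR fracK (valP i) (val_iota i)) => s0.
  by have := lt_valuationD (valP i) s_pos s0; rewrite subrK gh0 ltxx.
have val_sh j : val j (iota s * h) = (b j)%:E.
  rewrite (valuationM (valP j)) hb.
  rewrite (valuation_center noethR localR dimR fracK (valP j) (val_iota j) Nms).
  by rewrite add0e.
have If : I (g - iota s * h) by apply: fractional_idealB => //; exact: IM.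
have f_i : ((a i)%:E < val i (g - iota s * h))%E.
  have -> : g - iota s * h = (g / h - iota s) * h by rewrite mulrBl ghK.
  rewrite (valuationM (valP i)) hb abi.
  move: s_pos; case: (val i _) => [n||] //=; last by rewrite addye ?ltry.
  by rewrite -EFinD !lte_fin; lia.
have f_ge j : ((Order.min (a j) (b j))%:E <= val j (g - iota s * h))%E.
  apply: (le_valuationD (valP j)).
    by rewrite ga lee_fin ge_min lexx.
  by rewrite (valuationN (valP j)) val_sh lee_fin ge_min lexx orbT.
have f_eq j : a j != b j ->
    val j (g - iota s * h) = (Order.min (a j) (b j))%:E.
  move=> /lt_total/orP[ab|ba].
    rewrite (valuationDl (valP j)) ?(valuationN (valP j)) ?val_sh ga ?lte_fin //.
    by congr _%:E; lia.
  rewrite addrC (valuationDl (valP j)) (valuationN (valP j)) val_sh ?ga ?lte_fin //.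
  by congr _%:E; lia.
have [B abB] := upper_bound_ffun a b.
have [f' [If' uf' f'_eq f'_lt]] := perturb_to_unit B If.
have [c Ec f'c] := valuesP If' uf'.
(* Values above B, possibly infinite, may change under the perturbation but stay above B. *)
have lift j (x : int) : x <= B -> (x%:E < val j (g - iota s * h))%E ->
    (x%:E < val j f')%E.
  move=> xB xf; have [/f'_eq -> //|/f'_lt] := leP (val j (g - iota s * h)) B%:E.
  by apply: le_lt_trans; rewrite lee_fin.
exists c; split=> //.
- by rewrite -lte_fin -f'c lift //; case: (abB i).
- move=> j; rewrite -lee_fin -f'c.
  have [/f'_eq -> //|/f'_lt/ltW] := leP (val j (g - iota s * h)) B%:E.
  by apply: le_trans; rewrite lee_fin; case: (abB j) => + _; lia.
- move=> j /f_eq fj; have := f'_eq j; rewrite fj lee_fin f'c.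
  have [aB bB] := abB j; rewrite ge_min aB => /(_ isT) [].
  by [].
Qed.

End FractionalIdealValues.

(** * Residue representatives and the theorem *)

Lemma admissible_residues (R : comNzRingType) (m : set R)
    (K : comUnitRingType) (iota : {rmorphism R -> K}) p
    (val : 'I_p -> K -> \bar int) :
    local_ring m -> value_map iota val ->
    (dvrs iota #<= quotient_by setT m)%card ->
  exists r : 'I_p -> R, forall i j, i != j -> ~ m (r i - r j).
Proof.
move=> localR [_ [valV V_inj _]] /card_leP[f].
(* Composed with [V], the injection [f] selects p distinct cosets of m, one for each valuation. *)
pose V i : set_type (dvrs iota) := SigSub (mem_set (valV i Logic.I)).
have coset i : exists r, [set z | m (z - r)] = \val (f (V i)).
  by have [r _ <-] := set_mem (valP (f (V i))); exists r.
have [r rE] := choice coset.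
exists r => i j /negP ij mij; apply: ij; apply/eqP.
have [_ _ mD _] := local_maximal_ideal localR.
have coset_sub a b : m (b - a) -> [set z | m (z - b)] `<=` [set z | m (z - a)].
  by move=> mba z /= mz; rewrite -(subrK b z) -addrA; exact: mD.
have fV : f (V i) = f (V j).
  apply: val_inj; rewrite -!rE; apply/seteqP; split; apply: coset_sub => //.
  by rewrite -opprB; apply: is_idealN => //; exact: local_maximal_ideal.
have Vij : V i = V j by apply: (inj _ _ fV); rewrite inE.
by apply: V_inj; rewrite ?inE //; exact: (congr1 \val Vij).
Qed.

Theorem theorem4p1
  (R : comNzRingType) (m : set R)
  (K : comUnitRingType) (iota : {rmorphism R -> K})
  (R_admissible : admissible iota m)
  (p : nat) (p_ge2 : (2 <= p)%N)
  (val : 'I_p -> K -> \bar int) (val_map : value_map iota val)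
  (I : set K) (I_frac : fractional_ideal iota I)
  (v : {ffun 'I_p -> int})
  (v_proj : forall J : {set 'I_p}, #|J| = (p - 1)%N ->
     (pr J @` values val I) (pr J v)) :
  values val I v <->
  (forall alpha : {ffun 'I_p -> int},
     relative_maximals (values val I) alpha -> ~ Delta alpha setT v).
Proof.
have [[localR noethR dimR cmR] fracK _ residue_eq card_dvrs] := R_admissible.
have [y my y_reg] := cohen_macaulay_lreg dimR cmR.
have [valP [valV _ _]] := val_map.
have val_iota i r : (0 <= val i (iota r))%E.
  by have [+ _] := valV i Logic.I; apply; exists r.
have [r rP] := admissible_residues localR val_map card_dvrs.
apply: values_generated => //.
- exact: (values_min_closed noethR localR dimR fracK valP val_iota I_frac my
    y_reg rP).
- exact: (values_exchange noethR localR dimR fracK valP val_iota I_frac my y_reg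
    residue_eq).
(* The index sets of size p - 1 are the complements of single indices. *)
move=> k; have [|b Eb bv] := v_proj (~: [set k])%SET.
  by rewrite cardsC1 card_ord subn1.
exists b => // j jk; have jJ : j \in (~: [set k])%SET by rewrite !inE.
have := congr1 (fun w : {ffun _ -> _} => w (enum_rank_in jJ j)) bv.
by rewrite !ffunE enum_rankK_in.
Qed.
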